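(* Let $A$ be a pseudocompact C$^*$-algebra. Then every nonzero projection $q\in A$ dominates a minimal projection, i.e. there is a minimal projection $p\in A$ with $p\le q$.
   Context: A nonzero projection $p$ is minimal if it has no subprojection other than $0$ and $p$. $M_n$ denotes the C$^*$-algebra of complex $n\times n$ matrices, $n\ge 1$. Finite-dimensional C$^*$-algebras are, up to isomorphism, the (nonempty) finite direct sums of matrix algebras $M_n$. Continuous logic for C$^*$-algebras: atomic formulae are norms $\|P(x_1,\dots,x_k)\|$ of $*$-polynomials with complex coefficients (a constant $I$ for the identity may be used when the algebras are unital); formulae are built from these by applying continuous real-valued functions to finitely many formulae and by taking $\sup$ or $\inf$ of a variable over the closed unit ball. A sentence is a formula without free variables; $\varphi^A\in\mathbb{R}$ is its value in $A$. $A\equiv B$ (elementarily equivalent) if $\varphi^A=\varphi^B$ for every sentence $\varphi$. For an ultrafilter $\mathcal{U}$ on a set $I$, the ultraproduct $\prod_{\mathcal{U}}A_i$ is the C$^*$-algebra of bounded families $(a_i)_{i\in I}$ modulo those with $\lim_{\mathcal{U}}\|a_i\|=0$. A C$^*$-algebra is pseudocompact if it is elementarily equivalent to an ultraproduct of finite-dimensional C$^*$-algebras. *)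

(* Defs.v *)
From HB Require Import structures.
From mathcomp Require Import all_boot all_order all_algebra.
From mathcomp Require Import complex ring lra.
From mathcomp Require Import all_classical all_reals all_analysis.

Set Implicit Arguments.
Unset Strict Implicit.
Unset Printing Implicit Defensive.

Import Order.TTheory GRing.Theory Num.Theory.
Import numFieldNormedType.Exports.

Local Open Scope classical_set_scope.
Local Open Scope ring_scope.
Local Open Scope complex_scope.

(* A C*-algebra need not be unital, so its product is not a MathComp ring
   product. The norm of a [normedModType R[i]] has values in [R[i]]. *)
HB.mixin Record CompleteNormedModule_isCStarAlgebra (R : realType) A
    & CompleteNormedModule R[i] A := {
  cmul : A -> A -> A;
  star : A -> A;
  cmulA : associative cmul;
  cmulDl : left_distributive cmul +%R;
  cmulDr : right_distributive cmul +%R;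
  cmulZl : forall (c : R[i]) x y, cmul (c *: x) y = c *: cmul x y;
  cmulZr : forall (c : R[i]) x y, cmul x (c *: y) = c *: cmul x y;
  starK : involutive star;
  starD : {morph star : x y / x + y};
  starZ : forall (c : R[i]) x, star (c *: x) = c^*%C *: star x;
  starM : forall x y, star (cmul x y) = cmul (star y) (star x);
  normcM : forall x y : A, `|cmul x y| <= `|x| * `|y|;
  norm_cstar : forall x : A, `|cmul (star x) x| = `|x| ^+ 2
}.

#[short(type="cstarAlgType")]
HB.structure Definition CStarAlgebra (R : realType) :=
  {A of CompleteNormedModule_isCStarAlgebra R A & CompleteNormedModule R[i] A}.

Notation "x ** y" := (cmul x y) (at level 40, left associativity) : ring_scope.

Definition rnorm (R : realType) (A : cstarAlgType R) (x : A) : R := complex.Re `|x|.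

(* The zero algebra is excluded: up to isomorphism, these are the nonempty
   direct sums of matrix algebras M_n with n >= 1. *)
Definition finite_dimensional (R : realType) (A : cstarAlgType R) : Prop :=
  (exists x : A, x <> 0) /\
  exists (n : nat) (e : 'I_n -> A),
    forall x : A, exists c : 'I_n -> R[i], x = \sum_(i < n) c i *: e i.

Section Projections.
Variables (R : realType) (A : cstarAlgType R).

Definition projection (p : A) : Prop := star p = p /\ p ** p = p.

(* The order on projections; by taking adjoints it is the same as [q ** p = p]. *)
Definition proj_le (p q : A) : Prop := p ** q = p.

Definition minimal_projection (p : A) : Prop :=
  [/\ projection p, p <> 0 &
      forall r : A, projection r -> proj_le r p -> r = 0 \/ r = p].

End Projections.

(* *-polynomials in the variables x_0, ..., x_(n-1). They have no constant
   term: the algebras are not assumed to be unital. *)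
Inductive star_poly (R : realType) (n : nat) : Type :=
| SPvar of 'I_n
| SPzero
| SPadd of star_poly R n & star_poly R n
| SPscale of R[i] & star_poly R n
| SPmul of star_poly R n & star_poly R n
| SPstar of star_poly R n.
Arguments SPvar {R n}.
Arguments SPzero {R n}.

(* [formula R n]: formulae whose free variables are among x_0, ..., x_(n-1).
   [Fsup] and [Finf] bind x_0 and shift the other variables down by one. *)
Inductive formula (R : realType) (n : nat) : Type :=
| Fnorm of star_poly R n
| Fapp k (f : 'rV[R]_k -> R) of continuous f & ('I_k -> formula R n)
| Fsup of formula R n.+1
| Finf of formula R n.+1.

Notation sentence R := (formula R 0).

Definition vcons (T : Type) n (x : T) (v : 'I_n -> T) (i : 'I_n.+1) : T :=
  if unlift ord0 i is Some j then v j else x.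

Section Semantics.
Variables (R : realType) (A : cstarAlgType R).

Fixpoint poly_val n (t : star_poly R n) (v : 'I_n -> A) : A :=
  match t with
  | SPvar i => v i
  | SPzero => 0
  | SPadd t1 t2 => poly_val t1 v + poly_val t2 v
  | SPscale c t1 => c *: poly_val t1 v
  | SPmul t1 t2 => poly_val t1 v ** poly_val t2 v
  | SPstar t1 => star (poly_val t1 v)
  end.

(* [sup] and [inf] are taken over nonempty bounded sets of reals, so that
   their default values on other sets play no role. *)
Fixpoint formula_val n (phi : formula R n) : ('I_n -> A) -> R :=
  match phi with
  | Fnorm t => fun v => rnorm (poly_val t v)
  | Fapp k f _ phis => fun v => f (\row_(j < k) formula_val (phis j) v)
  | Fsup psi => fun v =>
      sup [set formula_val psi (vcons x v) | x in [set x : A | rnorm x <= 1]]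
  | Finf psi => fun v =>
      inf [set formula_val psi (vcons x v) | x in [set x : A | rnorm x <= 1]]
  end.

Definition sentence_val (phi : sentence R) : R :=
  formula_val phi (fun _ : 'I_0 => 0).

End Semantics.

Definition elementarily_equivalent (R : realType) (A B : cstarAlgType R) :=
  forall phi : sentence R, sentence_val A phi = sentence_val B phi.

Definition cabs (R : realType) (c : R[i]) : R := complex.Re `|c|.

Lemma cabsE (R : realType) (c : R[i]) : (cabs c)%:C = `|c|.
Proof. by rewrite RRe_real// ger0_real. Qed.

Section Rnorm.
Variables (R : realType) (A : cstarAlgType R).
Implicit Types x y : A.

Lemma rnormE x : (rnorm x)%:C = `|x|.
Proof. by rewrite RRe_real// ger0_real. Qed.

Lemma rnorm_ge0 x : 0 <= rnorm x.
Proof. by rewrite -lecR rnormE; exact: normr_ge0. Qed.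

Lemma rnorm0 : rnorm (0 : A) = 0.
Proof. by apply: complexI; rewrite rnormE normr0. Qed.

Lemma rnorm_eq0 x : rnorm x = 0 -> x = 0.
Proof. by move=> x0; apply/eqP; rewrite -normr_eq0 -rnormE x0. Qed.

Lemma rnormN x : rnorm (- x) = rnorm x.
Proof. by rewrite /rnorm normrN. Qed.

Lemma rnormD x y : rnorm (x + y) <= rnorm x + rnorm y.
Proof. by rewrite -lecR rmorphD/= !rnormE ler_normD. Qed.

Lemma rnormB x y : rnorm (x - y) <= rnorm x + rnorm y.
Proof. by rewrite -(rnormN y) rnormD. Qed.

Lemma cabs_ge0 (c : R[i]) : 0 <= cabs c.
Proof. by rewrite -lecR cabsE; exact: normr_ge0. Qed.

Lemma rnormZ (c : R[i]) x : rnorm (c *: x) = cabs c * rnorm x.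
Proof. by apply: complexI; rewrite rmorphM/= !rnormE cabsE normrZ. Qed.

Lemma rnormM x y : rnorm (x ** y) <= rnorm x * rnorm y.
Proof. by rewrite -lecR rmorphM/= !rnormE normcM. Qed.

Lemma rnorm_cstar x : rnorm (star x ** x) = rnorm x ^+ 2.
Proof. by apply: complexI; rewrite rmorphXn/= !rnormE norm_cstar. Qed.

Lemma star0 : star (0 : A) = 0.
Proof. by apply: (@addrI _ (star 0)); rewrite -starD !addr0. Qed.

Lemma starN x : star (- x) = - star x.
Proof. by apply: (@addrI _ (star x)); rewrite -starD !subrr star0. Qed.

Lemma cmul0x x : 0 ** x = 0.
Proof. by apply: (@addrI _ (0 ** x)); rewrite -cmulDl !addr0. Qed.

Lemma cmulx0 x : x ** 0 = 0.
Proof. by apply: (@addrI _ (x ** 0)); rewrite -cmulDr !addr0. Qed.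

Lemma cmulNx x y : (- x) ** y = - (x ** y).
Proof. by apply: (@addrI _ (x ** y)); rewrite -cmulDl !subrr cmul0x. Qed.

Lemma cmulxN x y : x ** (- y) = - (x ** y).
Proof. by apply: (@addrI _ (x ** y)); rewrite -cmulDr !subrr cmulx0. Qed.

Lemma rnorm_star_le x : rnorm x <= rnorm (star x).
Proof.
have [->|x0] := eqVneq x 0; first by rewrite star0.
have xgt0 : 0 < rnorm x.
  by rewrite lt0r rnorm_ge0 andbT; apply: contra_neq x0; exact: rnorm_eq0.
by have := rnormM (star x) x; rewrite rnorm_cstar expr2 ler_pM2r.
Qed.

Lemma rnorm_star x : rnorm (star x) = rnorm x.
Proof.
by apply/eqP; rewrite eq_le rnorm_star_le -{2}(starK x) rnorm_star_le.
Qed.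

End Rnorm.

Section Ulim.
Variables (R : realType) (I : Type) (U : set_system I).
Hypothesis UU : UltraFilter U.

Lemma ultra_bounded_cvg (f : I -> R) (M : R) :
  (forall i, `|f i| <= M) -> cvg (f @ U).
Proof.
move=> fM.
have := @segment_compact R (- M) M (f @ U) _.
case.
  by apply: (@filterE _ U) => i; have := fM i; rewrite /= in_itv ler_norml.
move=> l [_ lcl]; apply/cvg_ex; exists l => V /= Vl.
have [//|UV] := in_ultra_setVsetC (f @^-1` V) UU.
by have [z [/= nVz /nVz]] := lcl (~` V) V UV Vl.
Qed.

Lemma ulim_le (f g : I -> R) (l m : R) : f @ U --> l -> g @ U --> m ->
  (forall i, f i <= g i) -> l <= m.
Proof.
move=> fl gm fg; rewrite -subr_ge0; apply: (cvgr_to_ge (cvgB gm fl)).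
by apply: (@filterE _ U) => i; rewrite /= subr_ge0.
Qed.

End Ulim.

Section RapidlyCauchy.
Variable R : realType.
Let h (k : nat) : R := 2^-1 ^+ k.

Lemma halfX_gt0 k : 0 < h k.
Proof. by rewrite exprn_gt0// invr_gt0. Qed.

Lemma halfX_small (C e : R) : 0 < e -> exists k, C * h k < e.
Proof.
move=> e0; have [C0|C0] := leP C 0.
  by exists 0%N; rewrite (le_lt_trans _ e0)// mulr_le0_ge0// ltW// halfX_gt0.
have [k _ /(_ k (leqnn _))] := near_infty_natSinv_expn_lt (PosNum (divr_gt0 e0 C0)).
by exists k; rewrite mulrC -ltr_pdivlMr// /h exprVn -div1r.
Qed.

Lemma halfXS k : h k = h k.+1 + h k.+1.
Proof. by rewrite /h exprS -mulrDl; field. Qed.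

Lemma rapidly_cauchy_lim (A : cstarAlgType R) (s : nat -> A) (C : R) :
  (forall k m, rnorm (s (k + m)%N - s k) <= C * h k) ->
  exists l : A, forall k, rnorm (l - s k) <= C * h k.
Proof.
move=> sC.
have cs : cauchy (s @ \oo).
  apply: cauchy_exP => e e0.
  have e0' : 0 < complex.Re e by move: e0; rewrite ltcE => /andP[].
  have eE : e = (complex.Re e)%:C by rewrite RRe_real// gtr0_real.
  have [k ke] := halfX_small C e0'.
  exists (s k); exists k => // n /= kn.
  rewrite -ball_normE/= -rnormE eE ltcR (le_lt_trans _ ke)//.
  by rewrite -rnormN opprB -(subnKC kn).
have /cvg_ex[l sl] : cvg (s @ \oo) by exact: cauchy_cvg.
exists l => k; apply/ler_addgt0Pr => e e0.
have e0' : 0 < e%:C by rewrite ltcR.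
have /cvgrPdist_lt/(_ _ e0')[n _ ln] := sl.
have kn := ln (k + n)%N (leq_addl _ _).
rewrite -(subrK (s (k + n)%N) l) -addrA (le_trans (rnormD _ _))//.
by rewrite [leRHS]addrC lerD// -lecR rnormE ltW.
Qed.

End RapidlyCauchy.

Section BoundedFamilies.
Variables (R : realType) (I : Type) (B : I -> cstarAlgType R).

Record bounded_family := BoundedFamily {
  bfam :> forall i, B i;
  bfamP : exists M : R, forall i, rnorm (bfam i) <= M
}.

(* Excluded middle and choice make any type an [eqType] and a [choiceType]. *)
HB.instance Definition _ := gen_eqMixin bounded_family.
HB.instance Definition _ := gen_choiceMixin bounded_family.

Implicit Types a b : bounded_family.

Lemma bfam_eq a b : (forall i, a i = b i) -> a = b.
Proof.
case: a b => [a aP] [b bP] /= ab.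
have {}ab : a = b by exact: functional_extensionality_dep.
by rewrite ab in aP *; congr BoundedFamily; exact: Prop_irrelevance.
Qed.

Fact bfam0_subproof : exists M : R, forall i, rnorm (0 : B i) <= M.
Proof. by exists 0 => i; rewrite rnorm0. Qed.
Definition bfam0 := BoundedFamily bfam0_subproof.

Fact bfamD_subproof a b : exists M : R, forall i, rnorm (a i + b i) <= M.
Proof.
have [M aM] := bfamP a; have [N bN] := bfamP b; exists (M + N) => i.
by rewrite (le_trans (rnormD _ _))// lerD.
Qed.
Definition bfamD a b := BoundedFamily (bfamD_subproof a b).

Fact bfamZ_subproof (c : R[i]) a : exists M : R, forall i, rnorm (c *: a i) <= M.
Proof.
have [M aM] := bfamP a; exists (cabs c * M) => i.
by rewrite rnormZ ler_wpM2l// cabs_ge0.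
Qed.
Definition bfamZ c a := BoundedFamily (bfamZ_subproof c a).

Fact bfamN_subproof a : exists M : R, forall i, rnorm (- a i) <= M.
Proof. by have [M aM] := bfamP a; exists M => i; rewrite rnormN. Qed.
Definition bfamN a := BoundedFamily (bfamN_subproof a).

Fact bfamM_subproof a b : exists M : R, forall i, rnorm (a i ** b i) <= M.
Proof.
have [M aM] := bfamP a; have [N bN] := bfamP b; exists (M * N) => i.
by rewrite (le_trans (rnormM _ _))// ler_pM// rnorm_ge0.
Qed.
Definition bfamM a b := BoundedFamily (bfamM_subproof a b).

Fact bfamJ_subproof a : exists M : R, forall i, rnorm (star (a i)) <= M.
Proof. by have [M aM] := bfamP a; exists M => i; rewrite rnorm_star. Qed.
Definition bfamJ a := BoundedFamily (bfamJ_subproof a).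

End BoundedFamilies.

Section Ultraproduct.
Variables (R : realType) (I : Type) (U : set_system I) (UU : UltraFilter U).
Variable B : I -> cstarAlgType R.
Implicit Types (a b d : bounded_family B) (c : R[i]).

(* Along an ultrafilter this limit exists: see [unorm_cvg]. *)
Definition unorm a : R := lim ((fun i => rnorm (a i)) @ U).

Definition uequiv a b : bool :=
  `[< (fun i => rnorm (a i - b i)) @ U --> (0 : R) >].

Lemma unorm_cvg a : (fun i => rnorm (a i)) @ U --> unorm a.
Proof.
have [M aM] := bfamP a; apply: (ultra_bounded_cvg UU (M := M)) => i.
by rewrite ger0_norm ?rnorm_ge0.
Qed.
Arguments unorm_cvg : clear implicits.

Lemma unorm_lim a (l : R) : (fun i => rnorm (a i)) @ U --> l -> unorm a = l.
Proof. by move=> al; apply: (cvg_lim _ al). Qed.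

Lemma unorm_le a (M : R) : (\forall i \near U, rnorm (a i) <= M) -> unorm a <= M.
Proof. by move=> aM; exact: (cvgr_to_le (unorm_cvg a) aM). Qed.

Lemma unorm_ge0 a : 0 <= unorm a.
Proof.
apply: (cvgr_to_ge (unorm_cvg a)).
by apply: filterE => i; exact: rnorm_ge0.
Qed.

Lemma unorm_mono a b : (forall i, rnorm (a i) <= rnorm (b i)) ->
  unorm a <= unorm b.
Proof.
move=> ab; apply: (ulim_le UU (unorm_cvg a) (unorm_cvg b)).
exact: ab.
Qed.

Lemma unormD a b : unorm (bfamD a b) <= unorm a + unorm b.
Proof.
apply: (ulim_le UU (unorm_cvg (bfamD a b)) (cvgD (unorm_cvg a) (unorm_cvg b))).
by move=> i; exact: rnormD.
Qed.

Lemma unormM a b : unorm (bfamM a b) <= unorm a * unorm b.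
Proof.
apply: (ulim_le UU (unorm_cvg (bfamM a b)) (cvgM (unorm_cvg a) (unorm_cvg b))).
by move=> i; exact: rnormM.
Qed.

Lemma unormZ c a : unorm (bfamZ c a) = cabs c * unorm a.
Proof.
apply: unorm_lim => /=.
under [X in X @ U]eq_fun do rewrite rnormZ.
by apply: cvgMl_tmp; exact: unorm_cvg.
Qed.

Lemma unormN a : unorm (bfamN a) = unorm a.
Proof.
by rewrite /unorm; under [X in X @ U]eq_fun do rewrite rnormN.
Qed.

Lemma unormJ a : unorm (bfamJ a) = unorm a.
Proof.
by rewrite /unorm; under [X in X @ U]eq_fun do rewrite rnorm_star.
Qed.

Lemma unorm_cstar a : unorm (bfamM (bfamJ a) a) = unorm a ^+ 2.
Proof.
apply: unorm_lim => /=.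
under [X in X @ U]eq_fun do rewrite rnorm_cstar expr2.
by rewrite expr2; apply: cvgM; exact: unorm_cvg.
Qed.

Lemma unorm0 : unorm (bfam0 B) = 0.
Proof.
apply: unorm_lim => /=.
under [X in X @ U]eq_fun do rewrite rnorm0.
exact: cvg_cst.
Qed.

Definition bfamB a b := bfamD a (bfamN b).

Lemma uequivE a b : uequiv a b = (unorm (bfamB a b) == 0).
Proof.
apply/asboolP/eqP => [ab|ab0]; first by apply: unorm_lim; exact: ab.
by rewrite -ab0; exact: (unorm_cvg (bfamB a b)).
Qed.

Lemma uequiv_refl : reflexive uequiv.
Proof.
move=> a; rewrite uequivE -unorm0; apply/eqP; congr unorm.
by apply: bfam_eq => i /=; rewrite subrr.
Qed.

Lemma uequiv_sym : symmetric uequiv.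
Proof.
move=> a b; rewrite !uequivE -unormN; congr (unorm _ == 0).
by apply: bfam_eq => i /=; rewrite opprB.
Qed.

Lemma uequiv_trans : transitive uequiv.
Proof.
move=> b a d; rewrite !uequivE => /eqP ab /eqP bd.
rewrite eq_le unorm_ge0 andbT -(addr0 0) -{1}ab -bd.
apply: le_trans (unormD _ _); apply: unorm_mono => i /=.
by rewrite addrA subrK.
Qed.

Canonical uequiv_equiv := EquivRel uequiv uequiv_refl uequiv_sym uequiv_trans.

Definition ultraproduct := {eq_quot uequiv}%qT.

HB.instance Definition _ := Choice.on ultraproduct.
HB.instance Definition _ := EqQuotient.on ultraproduct.

Definition upi a : ultraproduct := (\pi_ultraproduct a)%qT.

Lemma upiP a b : upi a = upi b <-> unorm (bfamB a b) = 0.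
Proof.
split=> [/eqmodP|ab]; first by rewrite /= uequivE => /eqP.
by apply/eqmodP; rewrite /= uequivE ab.
Qed.

Lemma upi_repr (x : ultraproduct) : upi (repr x) = x.
Proof. exact: reprK. Qed.

Lemma reprP a : unorm (bfamB (repr (upi a)) a) = 0.
Proof. by apply/upiP; rewrite upi_repr. Qed.

Lemma upi_le a b d (M : R) : (forall i, rnorm (a i - b i) <= M * rnorm (d i)) ->
  unorm d = 0 -> upi a = upi b.
Proof.
move=> abd d0; apply/upiP/eqP; rewrite eq_le unorm_ge0 andbT.
rewrite -(mulr0 M) -d0.
apply: (ulim_le UU (unorm_cvg (bfamB a b)) (@cvgMl_tmp _ _ _ _ _ M _ (unorm_cvg d))).
exact: abd.
Qed.

Definition uadd (x y : ultraproduct) := upi (bfamD (repr x) (repr y)).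
Definition uopp (x : ultraproduct) := upi (bfamN (repr x)).
Definition uscale c (x : ultraproduct) := upi (bfamZ c (repr x)).
Definition umul (x y : ultraproduct) := upi (bfamM (repr x) (repr y)).
Definition ustar (x : ultraproduct) := upi (bfamJ (repr x)).
Definition uzero : ultraproduct := upi (bfam0 B).

Lemma uaddE a b : uadd (upi a) (upi b) = upi (bfamD a b).
Proof.
apply/upiP/eqP; rewrite eq_le unorm_ge0 andbT -(addr0 0).
rewrite -{1}(reprP a) -(reprP b); apply: le_trans (unormD _ _).
by apply: unorm_mono => i /=; rewrite addrACA opprD.
Qed.

Lemma uoppE a : uopp (upi a) = upi (bfamN a).
Proof.
apply: (@upi_le _ _ (bfamB (repr (upi a)) a) 1); last exact: reprP.
by move=> i /=; rewrite mul1r -opprD rnormN.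
Qed.

Lemma uscaleE c a : uscale c (upi a) = upi (bfamZ c a).
Proof.
apply: (@upi_le _ _ (bfamB (repr (upi a)) a) (cabs c)); last exact: reprP.
by move=> i /=; rewrite -scalerBr rnormZ.
Qed.

Lemma ustarE a : ustar (upi a) = upi (bfamJ a).
Proof.
apply: (@upi_le _ _ (bfamB (repr (upi a)) a) 1); last exact: reprP.
by move=> i /=; rewrite mul1r -starN -starD rnorm_star.
Qed.

Lemma umulE a b : umul (upi a) (upi b) = upi (bfamM a b).
Proof.
transitivity (upi (bfamM a (repr (upi b)))).
  have [M bM] := bfamP (repr (upi b)).
  apply: (@upi_le _ _ (bfamB (repr (upi a)) a) M); last exact: reprP.
  move=> i /=; rewrite -cmulNx -cmulDl mulrC (le_trans (rnormM _ _))//.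
  by rewrite ler_wpM2l// rnorm_ge0.
have [M aM] := bfamP a.
apply: (@upi_le _ _ (bfamB (repr (upi b)) b) M); last exact: reprP.
move=> i /=; rewrite -cmulxN -cmulDr (le_trans (rnormM _ _))//.
by rewrite ler_wpM2r// rnorm_ge0.
Qed.

Lemma upiW (P : ultraproduct -> Prop) : (forall a, P (upi a)) -> forall x, P x.
Proof. by move=> Pa x; rewrite -(upi_repr x). Qed.

Fact uaddA : associative uadd.
Proof.
move=> x y z; elim/upiW: x => a; elim/upiW: y => b; elim/upiW: z => d.
by rewrite !uaddE; congr upi; apply: bfam_eq => i /=; rewrite addrA.
Qed.

Fact uaddC : commutative uadd.
Proof.
move=> x y; elim/upiW: x => a; elim/upiW: y => b.
by rewrite !uaddE; congr upi; apply: bfam_eq => i /=; rewrite addrC.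
Qed.

Fact uadd0 : left_id uzero uadd.
Proof.
move=> x; elim/upiW: x => a.
by rewrite uaddE; congr upi; apply: bfam_eq => i /=; rewrite add0r.
Qed.

Fact uaddN : left_inverse uzero uopp uadd.
Proof.
move=> x; elim/upiW: x => a.
by rewrite uoppE uaddE; congr upi; apply: bfam_eq => i /=; rewrite addNr.
Qed.

HB.instance Definition _ :=
  GRing.isZmodule.Build ultraproduct uaddA uaddC uadd0 uaddN.

Lemma upiD a b : upi a + upi b = upi (bfamD a b). Proof. exact: uaddE. Qed.
Lemma upiN a : - upi a = upi (bfamN a). Proof. exact: uoppE. Qed.
Lemma upiB a b : upi a - upi b = upi (bfamB a b).
Proof. by rewrite upiN upiD. Qed.

Fact uscaleA c c' (x : ultraproduct) : uscale c (uscale c' x) = uscale (c * c') x.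
Proof.
elim/upiW: x => a.
by rewrite !uscaleE; congr upi; apply: bfam_eq => i /=; rewrite scalerA.
Qed.

Fact uscale1 : left_id 1 uscale.
Proof.
move=> x; elim/upiW: x => a.
by rewrite !uscaleE; congr upi; apply: bfam_eq => i /=; rewrite scale1r.
Qed.

Fact uscaleDr : right_distributive uscale +%R.
Proof.
move=> c x y; elim/upiW: x => a; elim/upiW: y => b.
rewrite !(uscaleE, upiD); congr upi.
by apply: bfam_eq => i /=; rewrite scalerDr.
Qed.

Fact uscaleDl (x : ultraproduct) : {morph uscale^~ x : c c' / c + c'}.
Proof.
move=> c c'; elim/upiW: x => a; rewrite !(uscaleE, upiD); congr upi.
by apply: bfam_eq => i /=; rewrite scalerDl.
Qed.

HB.instance Definition _ := GRing.Zmodule_isLmodule.Build R[i] ultraproduct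
  uscaleA uscale1 uscaleDr uscaleDl.

Lemma upiZ c a : c *: upi a = upi (bfamZ c a). Proof. exact: uscaleE. Qed.

Definition uqnorm (x : ultraproduct) : R[i] := (unorm (repr x))%:C.

Lemma uqnormE a : uqnorm (upi a) = (unorm a)%:C.
Proof.
have le b d : unorm (bfamB b d) = 0 -> unorm b <= unorm d.
  move=> bd0; rewrite -[leRHS]add0r -bd0; apply: le_trans (unormD _ _).
  by apply: unorm_mono => i /=; rewrite subrK.
have a0 := reprP a; congr (_%:C); apply/eqP; rewrite eq_le !le//.
by apply/eqP; rewrite -uequivE uequiv_sym uequivE a0.
Qed.

Fact uqnormD (x y : ultraproduct) : uqnorm (x + y) <= uqnorm x + uqnorm y.
Proof.
elim/upiW: x => a; elim/upiW: y => b.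
by rewrite upiD !uqnormE -rmorphD lecR unormD.
Qed.

Fact uqnormZ c (x : ultraproduct) : uqnorm (c *: x) = `|c| * uqnorm x.
Proof. by elim/upiW: x => a; rewrite upiZ !uqnormE unormZ rmorphM. Qed.

Fact uqnorm0_eq0 (x : ultraproduct) : uqnorm x = 0 -> x = 0.
Proof.
elim/upiW: x => a; rewrite uqnormE => /complexI a0.
apply: (@upi_le _ _ a 1) => // i /=.
by rewrite subr0 mul1r.
Qed.

HB.instance Definition _ := Lmodule_isNormed.Build R[i] ultraproduct
  uqnormD uqnormZ uqnorm0_eq0.

Lemma upi_norm a : `|upi a| = (unorm a)%:C. Proof. exact: uqnormE. Qed.

Let h (k : nat) : R := 2^-1 ^+ k.

Let hS k : h k = h k.+1 + h k.+1. Proof. exact: halfXS. Qed.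
Let h_gt0 k : 0 < h k. Proof. exact: halfX_gt0. Qed.

Fact ultraproduct_complete (F : set_system ultraproduct) :
  ProperFilter F -> cauchy F -> cvg F.
Proof.
move=> FF /cauchyP cF.
have hx k : exists x : ultraproduct, F (ball x (h k)%:C).
  by apply: cF; rewrite ltcR h_gt0.
have [x xF] := choice hx.
pose a k : bounded_family B := repr (x k).
have xa k : x k = upi (a k) by rewrite upi_repr.
have near_a k : \forall i \near U, rnorm (a k.+1 i - a k i) <= 2 * h k.
  have [y [yk yk1]] := filter_ex (filterI (xF k) (xF k.+1)).
  have ltx : `|x k.+1 - x k| < (2 * h k)%:C.
    rewrite -(subrK y (x k.+1)) -addrA (le_lt_trans (ler_normD _ _))//.
    move: yk yk1; rewrite -!ball_normE/= => yk yk1.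
    rewrite mulr_natl mulr2n rmorphD ltrD//; last by rewrite distrC.
    by rewrite (lt_trans yk1)// ltcR (hS k) ltrDl h_gt0.
  have uk : unorm (bfamB (a k.+1) (a k)) < 2 * h k.
    by move: ltx; rewrite !xa upiB upi_norm ltcR.
  have := unorm_cvg (bfamB (a k.+1) (a k)).
  move=> /cvgr_le /(_ _ uk).
  exact.
pose d k i : B i :=
  let y := a k.+1 i - a k i in if rnorm y <= 2 * h k then y else 0.
have dk k i : rnorm (d k i) <= 2 * h k.
  rewrite /d; case: ifP => // _.
  by rewrite rnorm0 mulr_ge0// ltW// h_gt0.
pose s i k : B i := a 0%N i + \sum_(j < k) d j i.
have sk i k m : rnorm (s i (k + m)%N - s i k) <= 4 * (h k - h (k + m)%N).
  elim: m => [|m IH]; first by rewrite addn0 !subrr rnorm0 mulr0.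
  have -> : s i (k + m.+1)%N - s i k = (s i (k + m)%N - s i k) + d (k + m)%N i.
    by rewrite /s addnS big_ord_recr/= addrA [LHS]addrAC.
  rewrite (le_trans (rnormD _ _))//.
  have := lerD IH (dk (k + m)%N i).
  by rewrite addnS; have := hS (k + m)%N; lra.
have sc i : exists l : B i, forall k, rnorm (l - s i k) <= 4 * h k.
  apply: rapidly_cauchy_lim => k m; apply: le_trans (sk i k m) _.
  by rewrite ler_wpM2l// gerBl ltW// h_gt0.
pose l i : B i := projT1 (cid (sc i)).
have lk i k : rnorm (l i - s i k) <= 4 * h k by exact: (projT2 (cid (sc i))).
have lb : exists M : R, forall i, rnorm (l i) <= M.
  have [M aM] := bfamP (a 0%N); exists (4 + M) => i.
  have := lk i 0%N; rewrite /s big_ord0 addr0 /h expr0 mulr1 => li.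
  by rewrite -(subrK (a 0%N i) (l i)) (le_trans (rnormD _ _))// lerD.
pose b : bounded_family B := BoundedFamily lb.
have near_s k : \forall i \near U, s i k = a k i.
  elim: k => [|k IH]; first by apply: filterE => i; rewrite /s big_ord0 addr0.
  apply: filterS2 IH (near_a k) => i IH dik.
  by rewrite /s big_ord_recr/= addrA -/(s i k) IH /d dik addrC subrK.
have bk k : `|upi b - x k| <= (4 * h k)%:C.
  rewrite xa upiB upi_norm lecR; apply: unorm_le.
  by apply: filterS (near_s k) => i /= <-; exact: lk.
apply/cvg_ex; exists (upi b); apply/cvg_ballP => e e0.
have e0' : 0 < complex.Re e by move: e0; rewrite ltcE => /andP[].
have eE : e = (complex.Re e)%:C by rewrite RRe_real// gtr0_real.
have [k ke] := halfX_small 5 e0'.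
apply: filterS (xF k) => y; rewrite -!ball_normE/= => xy.
rewrite -(subrK (x k) (upi b)) -addrA (le_lt_trans (ler_normD _ _))//.
rewrite (lt_trans (ler_ltD (bk k) xy))// -rmorphD eE ltcR.
by apply: le_lt_trans ke; rewrite -/(h k); lra.
Qed.

HB.instance Definition _ :=
  Uniform_isComplete.Build ultraproduct ultraproduct_complete.

Fact umulA : associative umul.
Proof.
move=> x y z; elim/upiW: x => a; elim/upiW: y => b; elim/upiW: z => d.
by rewrite !umulE; congr upi; apply: bfam_eq => i /=; rewrite cmulA.
Qed.

Fact umulDl : left_distributive umul +%R.
Proof.
move=> x y z; elim/upiW: x => a; elim/upiW: y => b; elim/upiW: z => d.
rewrite !(umulE, upiD); congr upi.
by apply: bfam_eq => i /=; rewrite cmulDl.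
Qed.

Fact umulDr : right_distributive umul +%R.
Proof.
move=> x y z; elim/upiW: x => a; elim/upiW: y => b; elim/upiW: z => d.
rewrite !(umulE, upiD); congr upi.
by apply: bfam_eq => i /=; rewrite cmulDr.
Qed.

Fact umulZl c (x y : ultraproduct) : umul (c *: x) y = c *: umul x y.
Proof.
elim/upiW: x => a; elim/upiW: y => b; rewrite !(umulE, upiZ); congr upi.
by apply: bfam_eq => i /=; rewrite cmulZl.
Qed.

Fact umulZr c (x y : ultraproduct) : umul x (c *: y) = c *: umul x y.
Proof.
elim/upiW: x => a; elim/upiW: y => b; rewrite !(umulE, upiZ); congr upi.
by apply: bfam_eq => i /=; rewrite cmulZr.
Qed.

Fact ustarK : involutive ustar.
Proof.
elim/upiW => a; rewrite !ustarE; congr upi.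
by apply: bfam_eq => i /=; rewrite starK.
Qed.

Fact ustarD : {morph ustar : x y / x + y}.
Proof.
elim/upiW => a; elim/upiW => b; rewrite !(ustarE, upiD); congr upi.
by apply: bfam_eq => i /=; rewrite starD.
Qed.

Fact ustarZ c (x : ultraproduct) : ustar (c *: x) = c^*%C *: ustar x.
Proof.
elim/upiW: x => a; rewrite !(ustarE, upiZ); congr upi.
by apply: bfam_eq => i /=; rewrite starZ.
Qed.

Fact ustarM (x y : ultraproduct) : ustar (umul x y) = umul (ustar y) (ustar x).
Proof.
elim/upiW: x => a; elim/upiW: y => b; rewrite !(ustarE, umulE); congr upi.
by apply: bfam_eq => i /=; rewrite starM.
Qed.

Fact uqnormM (x y : ultraproduct) : `|umul x y| <= `|x| * `|y|.
Proof.
elim/upiW: x => a; elim/upiW: y => b.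
by rewrite umulE !upi_norm -rmorphM lecR unormM.
Qed.

Fact uqnorm_cstar (x : ultraproduct) : `|umul (ustar x) x| = `|x| ^+ 2.
Proof.
elim/upiW: x => a.
by rewrite ustarE umulE !upi_norm unorm_cstar rmorphXn.
Qed.

HB.instance Definition _ :=
  CompleteNormedModule_isCStarAlgebra.Build R ultraproduct
    umulA umulDl umulDr umulZl umulZr ustarK ustarD ustarZ ustarM
    uqnormM uqnorm_cstar.

End Ultraproduct.

Definition pseudocompact (R : realType) (A : cstarAlgType R) : Prop :=
  exists (I : Type) (U : set_system I) (UU : UltraFilter U)
      (B : I -> cstarAlgType R),
    (forall i, finite_dimensional (B i)) /\
    elementarily_equivalent A (ultraproduct UU B).

(* Main.v *)
Require Import Defs.
From mathcomp Require Import all_boot all_order all_algebra.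
From mathcomp Require Import complex ring lra.
From mathcomp Require Import all_classical all_reals all_analysis.

(** A single sentence of continuous logic detects whether every nonzero
projection dominates a minimal one, so the property passes from ultraproducts
of finite-dimensional algebras to all pseudocompact algebras.

What makes this possible is that the relation u^* u = u defining projections
is weakly stable with a linear estimate, uniformly over all C*-algebras: every
element u lies within 1000 |u^* u - u| of a projection r, and r can be taken
below any projection p with u p = u ([projection_near]). Here r is the limit of a quadratically convergent polynomial iteration
started at u^* u. By completeness the limit exists, and since the polynomials
have no constant term, the equation u p = u survives.

In a finite-dimensional algebra a nonzero projection above no minimal one would
have arbitrarily many pairwise orthogonal nonzero projections below it, but
such families are linearly independent
([finite_dimensional_dominates_minimal]). In an ultraproduct, projections lift
to families of projections, and a projection below the class of (p_i) lifts to
projections below the p_i. Hence minimal projections chosen coordinatewise give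
a minimal projection ([ultraproduct_dominates_minimal]); this also avoids
evaluating formulae coordinatewise.

The sentence is sup_y inf_x sup_z of the quantity [gap]. Writing
d(u) = |u^* u - u|, it says: if y is closer to being a projection than to 0,
then some x is nearly a projection of norm one below y, and every z which is
nearly a projection below x is near 0 or near x. If nonzero projections
dominate minimal ones, linear stability makes the value at most 0
([minimality_sentence_le0]). Conversely, if the value is at most 0, take for y a
given projection q and let x be almost optimal. There is a projection p below q
near x, and a nonzero projection r below p must be near x, hence at distance less
than 1 from p. But p - r is a projection, so p = r
([minimality_sentence_dominates_minimal]). *)

Set Implicit Arguments.
Unset Strict Implicit.
Unset Printing Implicit Defensive.

Import Order.TTheory GRing.Theory Num.Theory.
Import numFieldNormedType.Exports.
Local Open Scope classical_set_scope.
Local Open Scope ring_scope.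
Local Open Scope complex_scope.

(** * Projections and their stability *)

Section Projections.
Variables (R : realType) (C : cstarAlgType R).
Implicit Types p q r u w x y z : C.

Lemma cmulBl x y z : (x - y) ** z = x ** z - y ** z.
Proof. by rewrite cmulDl cmulNx. Qed.

Lemma cmulBr x y z : x ** (y - z) = x ** y - x ** z.
Proof. by rewrite cmulDr cmulxN. Qed.

Lemma starB x y : star (x - y) = star x - star y.
Proof. by rewrite starD starN. Qed.

Lemma rnorm_distC x y : rnorm (x - y) = rnorm (y - x).
Proof. by rewrite -rnormN opprB. Qed.

Lemma rnorm_distD z x y : rnorm (x - y) <= rnorm (x - z) + rnorm (z - y).
Proof. by rewrite -{1}(subrK z x) -addrA rnormD. Qed.

Lemma rnormM_le a b x y : rnorm x <= a -> rnorm y <= b -> rnorm (x ** y) <= a * b.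
Proof.
move=> xa yb; apply: (le_trans (rnormM _ _)).
by apply: ler_pM => //; exact: rnorm_ge0.
Qed.

(** Vanishes exactly at the projections: u^* u = u forces u to be self-adjoint. *)
Definition defect u : R := rnorm (star u ** u - u).

Lemma defect_projection p : projection p -> defect p = 0.
Proof. by move=> [sp pp]; rewrite /defect sp pp subrr rnorm0. Qed.

Lemma projection0 : projection (0 : C).
Proof. by split; [exact: star0|exact: cmul0x]. Qed.

Lemma rnorm_projection p : projection p -> p <> 0 -> rnorm p = 1.
Proof.
move=> [sp pp] p0; have := rnorm_cstar p; rewrite sp pp expr2 => e.
have n0 : rnorm p != 0 by apply/eqP => /rnorm_eq0.
by apply: (mulfI n0); rewrite mulr1.
Qed.

Lemma rnorm_projection_le1 p : projection p -> rnorm p <= 1.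
Proof.
have [->|/eqP p0 pp] := eqVneq p 0; first by rewrite rnorm0.
by rewrite rnorm_projection.
Qed.

Lemma projection_small p : projection p -> rnorm p < 1 -> p = 0.
Proof.
by move=> pp p1; apply: contrapT => p0; move: p1; rewrite rnorm_projection// ltxx.
Qed.

Lemma proj_le_sym p q : projection p -> projection q -> proj_le p q -> q ** p = p.
Proof. by move=> [sp _] [sq _] /(congr1 star); rewrite starM sp sq. Qed.

Lemma projectionB p q : projection p -> projection q -> proj_le p q ->
  projection (q - p).
Proof.
move=> Pp Pq pq; have qp := proj_le_sym Pp Pq pq.
case: Pp Pq => [sp pp] [sq qq]; split; first by rewrite starB sp sq.
by rewrite cmulBl !cmulBr qq qp pq pp subrr subr0.
Qed.

Lemma proj_le_trans p q r : proj_le p q -> proj_le q r -> proj_le p r.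
Proof. by rewrite /proj_le => pq qr; rewrite -pq -cmulA qr. Qed.

(** The form in which equations pass to a limit of a rapidly Cauchy sequence. *)
Lemma small_eq0 x (M : R) : (forall k, rnorm x <= M * 2^-1 ^+ k) -> x = 0.
Proof.
move=> xM; apply: rnorm_eq0; apply/eqP; rewrite eq_le rnorm_ge0 andbT.
apply/ler_addgt0Pr => e e0; rewrite add0r.
by have [k /ltW] := halfX_small M e0; exact: le_trans.
Qed.

(** With e = w^2 - w, the correction f = e - 2 e w is e times the inverse of
1 - 2 w up to an error of order e^2, because (1 - 2 w)^2 = 1 + 4 e. So the
first-order part of the new defect cancels and only quadratic terms in e and
f remain. The multiples are spelled out as sums. *)
Lemma newton_defect w e f : e = w ** w - w -> f = e - (e ** w + e ** w) ->
  (w + f) ** (w + f) - (w + f) =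
  f ** f - (e ** e + e ** e + (e ** e + e ** e)).
Proof.
move=> eE fE.
have ew : w ** e = e ** w by rewrite eE cmulBl cmulBr cmulA.
have wf : w ** f = f ** w.
  by rewrite fE cmulBl cmulBr cmulDl cmulDr cmulA ew.
have ewwE : e ** w ** w = e ** e + e ** w.
  by rewrite -cmulA -cmulDr; congr (_ ** _); rewrite eE subrK.
have fw : f ** w = - (e ** w + (e ** e + e ** e)).
  rewrite fE cmulBl cmulDl ewwE addrACA addrA opprD addrCA subrr addr0.
  by rewrite [in RHS]addrC.
have f2fw : f - (f ** w + f ** w) = e + (e ** e + e ** e + (e ** e + e ** e)).
  by rewrite fw -opprD opprK addrACA fE [LHS]addrA subrK.
rewrite cmulDl !cmulDr wf.
transitivity (e - (f - (f ** w + f ** w)) + f ** f).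
  by rewrite opprB opprD eE !addrA [RHS](ACl (1*3*4*6*2*5)).
by rewrite f2fw opprD addrA subrr add0r addrC.
Qed.

(** One step w |-> 3 w^2 - 2 w^3 of the Newton iteration for w^2 = w, written
as w plus its correction term. *)
Definition newton w := w + (w ** w - w - ((w ** w - w) ** w + (w ** w - w) ** w)).

Lemma star_newton w : star w = w -> star (newton w) = newton w.
Proof.
move=> sw; rewrite /newton.
by rewrite !(starD, starN, starM, sw) cmulBl cmulDr cmulxN cmulA.
Qed.

(** Here |w|^2 = |w^2| <= |w| + 1, which bounds |w| a priori. *)
Lemma selfadjoint_le2 w : star w = w -> rnorm (w ** w - w) <= 1 -> rnorm w <= 2.
Proof.
move=> sw e1; have := rnorm_cstar w; rewrite sw => ww.
have := rnormD (w ** w - w) w; rewrite subrK ww.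
have := rnorm_ge0 w; nra.
Qed.

Lemma newton_dist w (E : R) : star w = w -> rnorm (w ** w - w) <= E -> E <= 1 ->
  rnorm (newton w - w) <= 5 * E.
Proof.
move=> sw eE E1; have w2 := selfadjoint_le2 sw (le_trans eE E1).
have ew := rnormM_le eE w2; rewrite /newton addrC addKr.
move: (w ** w - w) eE ew => e eE ew.
by have := rnormB e (e ** w + e ** w); have := rnormD (e ** w) (e ** w); lra.
Qed.

(** The new defect is at most 29 E^2; the bound on E turns this into a geometric
decay, which is all that convergence needs. *)
Lemma newton_halves w (E : R) : star w = w -> rnorm (w ** w - w) <= E ->
  E <= 64^-1 -> rnorm (newton w ** newton w - newton w) <= E * 2^-1.
Proof.
move=> sw eE E64; have E1 : E <= 1 by lra.
have := newton_dist sw eE E1; rewrite /newton.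
rewrite (newton_defect (erefl _) (erefl _)) addrC addKr.
move: (w ** w - w) eE => e eE.
set f := (_ - (_ + _)) => f5.
have e0 := rnorm_ge0 e.
have ee := rnormM_le eE eE; have ff := rnormM_le f5 f5.
have := rnormB (f ** f) (e ** e + e ** e + (e ** e + e ** e)).
have := rnormD (e ** e + e ** e) (e ** e + e ** e).
have := rnormD (e ** e) (e ** e); nra.
Qed.

(** The Newton iterates form a rapidly Cauchy sequence of self-adjoint elements;
their limit inherits every equation that the iterates satisfy in the limit. *)
Lemma newton_limit w (E : R) : star w = w -> rnorm (w ** w - w) <= E ->
  E <= 64^-1 ->
  exists r, [/\ projection r, rnorm (r - w) <= 10 * E &
                forall p, w ** p = w -> r ** p = r].
Proof.
move=> sw eE E64; pose h k : R := 2^-1 ^+ k.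
have h01 k : 0 <= h k <= 1.
  by rewrite /h exprn_ge0 ?invr_ge0//= exprn_ile1 ?invr_ge0//; lra.
have hS k : h k = h k.+1 + h k.+1 by exact: halfXS.
have E0 : 0 <= E := le_trans (rnorm_ge0 _) eE.
pose s k := iter k newton w.
have ss k : star (s k) = s k by elim: k => //= k; exact: star_newton.
have Eh k : E * h k <= E by have := h01 k; nra.
have se k : rnorm (s k ** s k - s k) <= E * h k.
  elim: k => [|k IH]; first by rewrite /h expr0 mulr1.
  rewrite /h exprSr mulrA; apply: newton_halves => //.
  exact: le_trans (Eh k) E64.
have E1 : E <= 1 by lra.
have sd k : rnorm (s k.+1 - s k) <= 5 * (E * h k).
  by apply: newton_dist => //; exact: le_trans (Eh k) E1.
have sc k m : rnorm (s (k + m)%N - s k) <= 10 * E * (h k - h (k + m)%N).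
  elim: m => [|m IH]; first by rewrite addn0 !subrr rnorm0 mulr0.
  have := rnorm_distD (s (k + m)%N) (s (k + m.+1)%N) (s k).
  by have := sd (k + m)%N; rewrite (hS (k + m)%N) -addnS in IH *; lra.
have [l ls] : exists l, forall k, rnorm (l - s k) <= 10 * E * h k.
  apply: rapidly_cauchy_lim => k m; apply: le_trans (sc k m) _.
  apply: ler_wpM2l; first lra.
  by rewrite gerBl; case/andP: (h01 (k + m)%N).
have s2 k : rnorm (s k) <= 2.
  by apply: selfadjoint_le2 => //; apply: le_trans (se k) _; exact: le_trans (Eh k) E1.
have l3 : rnorm l <= 3.
  have := rnormD (l - s 0%N) (s 0%N); rewrite subrK.
  by have := ls 0%N; have := s2 0%N; rewrite /h expr0; lra.
exists l; split; last 1 first.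
- move=> p wp.
  have sp k : s k ** p = s k.
    elim: k => // k IH; rewrite /s iterS -/(s k) /newton.
    by rewrite !(cmulDl, cmulNx) -!cmulA !IH.
  apply/eqP; rewrite -subr_eq0; apply/eqP.
  apply: (@small_eq0 _ (10 * E * (rnorm p + 1))) => k.
  have -> : l ** p - l = (l - s k) ** p - (l - s k).
    by rewrite cmulBl sp opprB subrKA.
  have := rnormB ((l - s k) ** p) (l - s k).
  have := rnormM_le (ls k) (lexx (rnorm p)); have := ls k.
  by rewrite -/(h k); lra.
- split.
    apply/eqP; rewrite -subr_eq0; apply/eqP.
    apply: (@small_eq0 _ (20 * E)) => k.
    have := rnorm_distD (s k) (star l) l.
    rewrite -{1}(ss k) -starB rnorm_star [rnorm (s k - l)]rnorm_distC.
    by have := ls k; rewrite -/(h k); lra.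
  apply/eqP; rewrite -subr_eq0; apply/eqP.
  apply: (@small_eq0 _ (61 * E)) => k.
  have := rnorm_distD (s k ** s k - s k) (l ** l - l) 0; rewrite !subr0.
  have := se k; have := ls k; rewrite -/(h k) => lsk sek.
  have -> : l ** l - l - (s k ** s k - s k) =
            (l - s k) ** l + s k ** (l - s k) - (l - s k).
    rewrite cmulBl cmulBr subrKA !opprB addrACA [RHS]addrACA.
    by congr (_ + _); exact: addrC.
  have := rnormM_le lsk l3; have := rnormM_le (s2 k) lsk.
  have := rnormB ((l - s k) ** l + s k ** (l - s k)) (l - s k).
  have := rnormD ((l - s k) ** l) (s k ** (l - s k)); lra.
by have := ls 0%N; rewrite /h expr0 mulr1.
Qed.

(** Weak stability of projections. If the bound is at least |u|,
take r = 0. Otherwise |u|^2 <= |u| + defect u bounds u, the self-adjoint element u^* u is almost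
idempotent, and Newton's iteration starts there. *)
Lemma projection_near u :
  exists r, [/\ projection r, rnorm (r - u) <= 1000 * defect u &
                forall p, u ** p = u -> r ** p = r].
Proof.
set e := defect u.
have [ue|eu] := leP (rnorm u) (1000 * e).
  exists 0; split; [exact: projection0|by rewrite sub0r rnormN|].
  by move=> p _; rewrite cmul0x.
have uu := rnorm_cstar u.
have u0 := rnorm_ge0 u.
have e0 : 0 <= e by exact: rnorm_ge0.
have ueu : rnorm u ^+ 2 <= e + rnorm u.
  by rewrite -uu -[X in rnorm X](subrK u); exact: rnormD.
have u2 : rnorm u <= 2 by nra.
pose w := star u ** u.
have wu : rnorm (w - u) <= e by exact: lexx.
have sw : star w = w by rewrite /w starM starK.
have w4 : rnorm w <= 3 by rewrite /w uu; nra.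
have we : rnorm (w ** w - w) <= 5 * e.
  have -> : w ** w - w = w ** (w - u) + star (w - u) ** u.
    by rewrite starB sw cmulBr cmulBl -/w addrA subrK.
  have := rnormD (w ** (w - u)) (star (w - u) ** u).
  have := rnormM_le w4 wu.
  have : rnorm (star (w - u)) <= e by rewrite rnorm_star.
  move=> /rnormM_le /(_ u2); lra.
have [|r [Pr rw rp]] := newton_limit sw we; first by lra.
exists r; split => //.
  by have := rnorm_distD w r u; lra.
by move=> p up; apply: rp; rewrite /w -cmulA up.
Qed.

(** The relative version, obtained by applying stability to z p. *)
Lemma projection_near_below p z : projection p -> rnorm z <= 1 ->
  exists r, [/\ projection r, proj_le r p &
    rnorm (r - z) <= 5000 * (defect z + rnorm (z ** p - z))].
Proof.
move=> Pp z1; have p1 := rnorm_projection_le1 Pp; case: Pp => sp pp.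
have [r [Pr rz rp]] := projection_near (z ** p).
rewrite /defect in rz *.
exists r; split => //; first by apply: rp; rewrite -cmulA pp.
set d := rnorm (z ** p - z); have d0 : 0 <= d by exact: rnorm_ge0.
have zp1 : rnorm (star (z ** p)) <= 1.
  by rewrite rnorm_star -(mulr1 1); exact: rnormM_le.
have sz1 : rnorm (star (z ** p - z)) <= d by rewrite rnorm_star.
have zpz : star (z ** p) ** (z ** p) - z ** p =
    star (z ** p) ** (z ** p - z) + star (z ** p - z) ** z
    + (star z ** z - z) - (z ** p - z).
  by rewrite cmulBr starB cmulBl subrKA addrA opprB subrK addrA subrK.
have := rnorm_distD (z ** p) r z; rewrite -/d.
move: rz; rewrite zpz; set a := (_ ** (_ - _)); set b := _ ** z.
set c := star z ** z - z.
have := rnormB (a + b + c) (z ** p - z); have := rnormD (a + b) c.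
have := rnormD a b; have := rnormM_le zp1 (lexx d); have := rnormM_le sz1 z1.
rewrite -/a -/b -/d; have := rnorm_ge0 c; lra.
Qed.

End Projections.

(** * Finite-dimensional algebras *)

Definition dominates_minimal (R : realType) (C : cstarAlgType R) (q : C) :=
  exists p : C, minimal_projection p /\ proj_le p q.

Section FiniteDimensional.
Variables (R : realType) (C : cstarAlgType R).
Implicit Types p q r : C.

Lemma not_minimal_projection q : projection q -> q <> 0 -> ~ minimal_projection q ->
  exists r, [/\ projection r, proj_le r q, r <> 0 & r <> q].
Proof.
move=> Pq q0 nq; apply: contrapT => nr; apply: nq; split=> // r Pr rq.
by apply: contrapT => /not_orP[r0 rnq]; apply: nr; exists r.
Qed.

(** Descend from q to a smaller nonzero r, which again dominates no minimal
projection, and add q - r to the family found below r. *)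
Lemma orthogonal_projections_below q k : projection q -> q <> 0 ->
  ~ dominates_minimal q ->
  exists s : 'I_k -> C, (forall j, [/\ projection (s j), s j <> 0 & proj_le (s j) q]) /\
    forall i j, i != j -> s i ** s j = 0.
Proof.
elim: k q => [|k IH] q Pq q0 nq; first by exists (fun=> 0); split=> -[].
have [|r [Pr rq r0 rnq]] := not_minimal_projection Pq q0.
  by move=> mq; apply: nq; exists q; split=> //; case: Pq.
have nr : ~ dominates_minimal r.
  move=> [p [mp pr]]; apply: nq; exists p; split=> //; exact: proj_le_trans pr rq.
have [s [sP so]] := IH r Pr r0 nr.
have qr := projectionB Pr Pq rq.
have sqr j : s j ** (q - r) = 0.
  by have [_ _ sr] := sP j; rewrite cmulBr (proj_le_trans sr rq) sr subrr.
have qrs j : (q - r) ** s j = 0.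
  have [[ss _] _ _] := sP j.
  by rewrite -[q - r](proj1 qr) -{1}ss -starM sqr star0.
exists (vcons (q - r) s); split.
  move=> j; rewrite /vcons; case: unliftP => [i _|_].
    by have [Ps s0 sr] := sP i; split=> //; exact: proj_le_trans sr rq.
  split=> //; first by move=> /eqP; rewrite subr_eq0 => /eqP /esym.
  by rewrite /proj_le cmulBl rq; case: Pq => _ ->.
move=> i j; rewrite /vcons.
case: (unliftP ord0 i) => [i' ->|->]; case: (unliftP ord0 j) => [j' ->|->] //.
  by move=> ij; apply: so; apply: contra_neq ij => ->.
Qed.

(** If m > n, the m x n matrix of coordinates has a nonzero row kernel, which is a
linear relation between the projections. Multiplying it by s_j isolates its
j-th coefficient. *)
Lemma orthogonal_projections_le n m (e : 'I_n -> C) (s : 'I_m -> C) :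
  (forall x, exists c : 'I_n -> R[i], x = \sum_(i < n) c i *: e i) ->
  (forall j, projection (s j) /\ s j <> 0) ->
  (forall i j, i != j -> s i ** s j = 0) -> (m <= n)%N.
Proof.
move=> span sP so; have [c sE] := choice (fun j => span (s j)).
pose M := \matrix_(j < m, i < n) c j i.
rewrite leqNgt; apply/negP => nm.
have : kermx M != 0.
  rewrite -mxrank_eq0 mxrank_ker -lt0n subn_gt0.
  exact: leq_ltn_trans (rank_leq_col M) nm.
move=> /rowV0Pn[v /sub_kermxP vM v0].
have vs : \sum_j v 0 j *: s j = 0.
  under eq_bigr => j _ do rewrite sE scaler_sumr.
  rewrite exchange_big/= big1// => i _.
  under eq_bigr => j _ do rewrite scalerA.
  rewrite -scaler_suml -[RHS](scale0r (e i)); congr (_ *: _).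
  move/matrixP: vM => /(_ 0 i); rewrite !mxE => vMi.
  by rewrite -[RHS]vMi; apply: eq_bigr => j _; rewrite mxE.
move: v0 => /negP; apply; apply/eqP/rowP => j; rewrite mxE.
have [[_ ss] s0] := sP j.
have : (\sum_j v 0 j *: s j) ** s j = v 0 j *: s j.
  rewrite (big_morph (cmul^~ (s j)) (fun x y => cmulDl x y (s j)) (cmul0x (s j))).
  rewrite (bigD1 j)//= cmulZl ss big1 ?addr0// => i ij.
  by rewrite cmulZl so// scaler0.
rewrite vs cmul0x => /esym/eqP; rewrite scaler_eq0 => /orP[/eqP//|/eqP].
by move/s0.
Qed.

Lemma finite_dimensional_dominates_minimal q : finite_dimensional C ->
  projection q -> q <> 0 -> dominates_minimal q.
Proof.
move=> [_ [n [e span]]] Pq q0; apply: contrapT => nq.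
have [s [sP so]] := orthogonal_projections_below n.+1 Pq q0 nq.
have : (n.+1 <= n)%N.
  by apply: (orthogonal_projections_le span _ so) => j; have [] := sP j.
by rewrite ltnn.
Qed.

End FiniteDimensional.

(** * Ultraproducts *)

Section Ultraproduct.
Variables (R : realType) (I : Type) (U : set_system I) (UU : UltraFilter U).
Variable B : I -> cstarAlgType R.
Implicit Types a b p s : bounded_family B.

Lemma upi_eq_near a b : (\forall i \near U, a i = b i) -> upi UU a = upi UU b.
Proof.
move=> ab; apply/upiP/eqP; rewrite eq_le unorm_ge0 andbT; apply: unorm_le => //.
by apply: filterS ab => i /= ->; rewrite subrr rnorm0.
Qed.

Lemma upiM a b : upi UU a ** upi UU b = upi UU (bfamM a b).
Proof. exact: umulE. Qed.

Lemma upi_star a : star (upi UU a) = upi UU (bfamJ a).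
Proof. exact: ustarE. Qed.

Lemma upi_projection a : (forall i, projection (a i)) ->
  projection (upi UU a).
Proof.
move=> Pa; split; rewrite ?upi_star ?upiM; congr upi; apply: bfam_eq => i /=;
  by case: (Pa i).
Qed.

(** A nonzero projection has norm 1, so norms that tend to 0 vanish near U. *)
Lemma upi_projection_eq0 a : (forall i, projection (a i)) -> upi UU a = 0 ->
  \forall i \near U, a i = 0.
Proof.
move=> Pa a0.
have ua : unorm U a = 0.
  by apply: complexI; rewrite -upi_norm a0 normr0.
have := unorm_cvg UU (a:=a); rewrite ua => /cvgr_lt /(_ 1 ltr01).
by apply: filterS => i; exact: projection_small.
Qed.

(** Stability in each coordinate, with one constant for all coordinates. The last
clause lets the lift stay below prescribed projections. *)
Lemma projection_lift a : projection (upi UU a) ->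
  exists r : bounded_family B, [/\ forall i, projection (r i), upi UU r = upi UU a &
                forall i (x : B i), a i ** x = a i -> r i ** x = r i].
Proof.
move=> [sa aa]; pose near i := cid (projection_near (a i)).
pose f i := projT1 (near i).
have Pf i : projection (f i) by case: (projT2 (near i)).
have fb : exists M : R, forall i, rnorm (f i) <= M.
  by exists 1 => i; exact: rnorm_projection_le1.
exists (BoundedFamily fb); split=> //; last by move=> i; case: (projT2 (near i)).
apply: (@upi_le _ _ _ _ _ _ _ (bfamB (bfamM (bfamJ a) a) a) 1000).
  by move=> i; case: (projT2 (near i)).
by apply/upiP; rewrite -upiM -upi_star sa.
Qed.

(** Minimality of the class of (p_i): a projection below it lifts to projections
b_i below p_i, so each b_i is 0 or p_i, and the ultrafilter decides which. *)
Lemma ultraproduct_dominates_minimal (q : ultraproduct UU B) :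
  (forall i (b : B i), projection b -> b <> 0 -> dominates_minimal b) ->
  projection q -> q <> 0 -> dominates_minimal q.
Proof.
move=> minB; elim/upiW: q => a0 /projection_lift[a [Pa <- _]] qn0.
have minp i : exists p : B i, [/\ projection p, proj_le p (a i) &
                               a i <> 0 -> minimal_projection p].
  have [ai0|/eqP ai0] := eqVneq (a i) 0.
    by exists 0; split; [exact: projection0|exact: cmul0x|].
  have [p [mp pa]] := minB i (a i) (Pa i) ai0.
  by exists p; split=> //; case: mp.
pose f i := projT1 (cid (minp i)).
have fb : exists M : R, forall i, rnorm (f i) <= M.
  exists 1 => i; apply: rnorm_projection_le1.
  by rewrite /f; case: cid => p [].
have Pf i : projection (f i) by rewrite /f; case: cid => p [].
have fa i : proj_le (f i) (a i) by rewrite /f; case: cid => p [].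
have mf i : a i <> 0 -> minimal_projection (f i) by rewrite /f; case: cid => p [].
pose p := BoundedFamily fb.
exists (upi UU p); split; last first.
  by rewrite /proj_le upiM; congr upi; apply: bfam_eq => i /=; exact: fa.
split.
- exact: upi_projection.
- move=> /(upi_projection_eq0 (a := p) Pf) p0; apply: qn0.
  apply: upi_eq_near; apply: filterS p0 => i /= fi0.
  by apply: contrapT => /mf[].
- move=> r; elim/upiW: r => b0 Pr rp.
  (* b0 p represents the same element, and its coordinates are fixed by p_i. *)
  have bpE : upi UU (bfamM b0 p) = upi UU b0 by rewrite -upiM.
  have := Pr; rewrite -bpE => /projection_lift[b [Pb bE bp]].
  rewrite -bE.
  have {}bp i : proj_le (b i) (f i).
    by apply: bp => /=; rewrite -cmulA; case: (Pf i) => _ ->.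
  have [b0U|b0U] := in_ultra_setVsetC [set i | b i = 0] UU.
    by left; apply: upi_eq_near; apply: filterS b0U.
  right; apply: upi_eq_near; apply: filterS b0U => i /= bi0.
  have ai0 : a i <> 0.
    by move=> ai0; apply: bi0; rewrite -(bp i) -(fa i) ai0 !cmulx0.
  by have [_ _ /(_ _ (Pb i) (bp i))[]] := mf i ai0.
Qed.

End Ultraproduct.

(** * Connectives and quantifiers *)

Section Connectives.
Variables (R : realType) (n : nat).
Implicit Types phi psi : formula R n.

Lemma coord_row_continuous k (i : 'I_k) : continuous (fun v : 'rV[R]_k => v 0 i).
Proof. exact: coord_continuous. Qed.

Lemma max_row_continuous : continuous (fun v : 'rV[R]_2 => Num.max (v 0 0) (v 0 1)).
Proof. by move=> v; apply: continuous_max; exact: coord_row_continuous. Qed.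

Lemma min_row_continuous : continuous (fun v : 'rV[R]_2 => Num.min (v 0 0) (v 0 1)).
Proof. by move=> v; apply: continuous_min; exact: coord_row_continuous. Qed.

Lemma addZ_row_continuous (c : R) : continuous (fun v : 'rV[R]_2 => v 0 0 + c * v 0 1).
Proof.
move=> v.
exact: (cvgD (@coord_row_continuous 2 0 v)
             (cvgMl_tmp (a := c) (@coord_row_continuous 2 1 v))).
Qed.

Definition pair_formula phi psi (j : 'I_2) := if j == 0 then phi else psi.
Definition Fmax phi psi := Fapp max_row_continuous (pair_formula phi psi).
Definition Fmin phi psi := Fapp min_row_continuous (pair_formula phi psi).
Definition FaddZ phi c psi := Fapp (@addZ_row_continuous c) (pair_formula phi psi).
Definition Fcst c : formula R n :=
  Fapp (fun v => @cst_continuous 'rV[R]_0 R c v) (fun j => Fnorm SPzero).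
(** Clamping to [-1, 1] bounds every supremum and infimum uniformly over all
algebras; the argument only compares values with 0 and with numbers below 1. *)
Definition Fclamp phi := Fmax (Fcst (-1)) (Fmin (Fcst 1) phi).

Variable A : cstarAlgType R.
Implicit Type v : 'I_n -> A.

Lemma Fmax_val phi psi v : formula_val (Fmax phi psi) v =
  Num.max (formula_val phi v) (formula_val psi v).
Proof. by rewrite /= !mxE. Qed.

Lemma Fmin_val phi psi v : formula_val (Fmin phi psi) v =
  Num.min (formula_val phi v) (formula_val psi v).
Proof. by rewrite /= !mxE. Qed.

Lemma FaddZ_val phi c psi v : formula_val (FaddZ phi c psi) v =
  formula_val phi v + c * formula_val psi v.
Proof. by rewrite /= !mxE. Qed.

Lemma Fclamp_val phi v : formula_val (Fclamp phi) v =
  Num.max (-1) (Num.min 1 (formula_val phi v)).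
Proof. by rewrite /Fclamp Fmax_val Fmin_val. Qed.

End Connectives.

Section Quantifiers.
Variables (R : realType) (A : cstarAlgType R) (n : nat) (psi : formula R n.+1).
Implicit Types (v : 'I_n -> A) (x : A) (c : R).

Lemma Fsup_le v c :
  (forall x, rnorm x <= 1 -> formula_val psi (vcons x v) <= c) ->
  formula_val (Fsup psi) v <= c.
Proof.
move=> h; apply: ge_sup; last by move=> _ [x x1 <-]; exact: h.
by exists (formula_val psi (vcons 0 v)), 0 => //=; rewrite rnorm0.
Qed.

Lemma Finf_lt v c : formula_val (Finf psi) v < c ->
  exists x, rnorm x <= 1 /\ formula_val psi (vcons x v) < c.
Proof.
move=> /inf_lt[|_ [x x1 <-] xc]; last by exists x.
by exists (formula_val psi (vcons 0 v)), 0 => //=; rewrite rnorm0.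
Qed.

Hypothesis psi1 : forall w : 'I_n.+1 -> A, `|formula_val psi w| <= 1.

Lemma Fsup_ge v x : rnorm x <= 1 ->
  formula_val psi (vcons x v) <= formula_val (Fsup psi) v.
Proof.
move=> x1; apply: ub_le_sup; last by exists x.
by exists 1 => _ [y _ <-]; exact: le_trans (ler_norm _) (psi1 _).
Qed.

Lemma Finf_le v x : rnorm x <= 1 ->
  formula_val (Finf psi) v <= formula_val psi (vcons x v).
Proof.
move=> x1; apply: ge_inf; last by exists x.
by exists (-1) => _ [y _ <-]; have := psi1 (vcons y v); rewrite ler_norml => /andP[].
Qed.

Lemma Fsup_norm_le1 v : `|formula_val (Fsup psi) v| <= 1.
Proof.
rewrite ler_norml; apply/andP; split.
  apply: le_trans (Fsup_ge v (x := 0) _); last by rewrite rnorm0.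
  by have := psi1 (vcons 0 v); rewrite ler_norml => /andP[].
by apply: Fsup_le => x _; exact: le_trans (ler_norm _) (psi1 _).
Qed.

Lemma Finf_norm_le1 v : `|formula_val (Finf psi) v| <= 1.
Proof.
rewrite ler_norml; apply/andP; split.
  rewrite leNgt; apply/negP => /Finf_lt[x [_]].
  by rewrite ltNge; have := psi1 (vcons x v); rewrite ler_norml => /andP[->].
apply: (le_trans (Finf_le v (x := 0) _)); first by rewrite rnorm0.
exact: le_trans (ler_norm _) (psi1 _).
Qed.

End Quantifiers.

(** * The sentence *)

Section Sentence.
Variables (R : realType).

Definition SPsub n (s t : star_poly R n) := SPadd s (SPscale (-1) t).

Definition Fdefect n (t : star_poly R n) := Fnorm (SPsub (SPmul (SPstar t) t) t).

(** The innermost quantifier binds index 0, so that z, x, y are numbered from the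
inside out. *)
Definition gap_formula : formula R 3 :=
  let z := SPvar ord0 in
  let x := SPvar (lift ord0 ord0) in
  let y := SPvar (lift ord0 (lift ord0 ord0)) in
  Fclamp (Fmin (FaddZ (Fnorm y) (-1000) (Fdefect y))
    (Fmax (FaddZ (FaddZ (FaddZ (FaddZ (Fnorm y) (-1) (Fnorm x))
                               1 (Fdefect x))
                        1 (Fnorm (SPsub (SPmul x y) x)))
                 (-1000) (Fdefect y))
       (FaddZ (FaddZ (Fmin (Fnorm z) (Fnorm (SPsub x z))) (-5000) (Fdefect z))
              (-5000) (Fnorm (SPsub (SPmul z x) z))))).

Definition minimality_sentence : sentence R := Fsup (Finf (Fsup gap_formula)).

Variable A : cstarAlgType R.
Implicit Types p q r x y z : A.

(** The first term is positive only if y is close to a nonzero projection. The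
second measures how far x is from being a projection of norm |y| below y, less
the error that y itself causes. The third is positive only if z is nearly a
projection below x without being near 0 or x. The factors 1000 and 5000 are the
stability constants of [projection_near] and [projection_near_below]; the
factors 1 reproduce the shape of the formula. *)
Definition gap y x z : R :=
  Num.min (rnorm y + - 1000 * defect y)
    (Num.max (rnorm y + - 1 * rnorm x + 1 * defect x + 1 * rnorm (x ** y - x)
              + - 1000 * defect y)
      (Num.min (rnorm z) (rnorm (x - z)) + - 5000 * defect z
       + - 5000 * rnorm (z ** x - z))).

Lemma vcons0 (T : Type) n (x : T) (v : 'I_n -> T) : vcons x v ord0 = x.
Proof. by rewrite /vcons unlift_none. Qed.

Lemma vconsS (T : Type) n (x : T) (v : 'I_n -> T) i :
  vcons x v (lift ord0 i) = v i.
Proof. by rewrite /vcons liftK. Qed.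

Lemma gap_formula_val y x z v :
  formula_val gap_formula (vcons z (vcons x (vcons y v))) =
  Num.max (-1) (Num.min 1 (gap y x z)).
Proof.
rewrite Fclamp_val Fmin_val Fmax_val !FaddZ_val Fmin_val /=.
by rewrite !vconsS !vcons0 !scaleN1r.
Qed.

Lemma gap_formula_norm_le1 (v : 'I_3 -> A) : `|formula_val gap_formula v| <= 1.
Proof.
rewrite Fclamp_val ler_norml le_max lexx/= ge_max ge_min lexx/=.
by rewrite andbT; lra.
Qed.

(** Given y, witnesses come from stability: a projection q near y, then a minimal
p below q as the value of x. A projection r below p near z is 0 or p. *)
Lemma minimality_sentence_le0 :
  (forall q, projection q -> q <> 0 -> dominates_minimal q) ->
  sentence_val A minimality_sentence <= 0.
Proof.
move=> minA; apply: Fsup_le => y y1.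
set v := vcons _ _.
suff [x [x1 gap0]] : exists x, rnorm x <= 1 /\ forall z, rnorm z <= 1 -> gap y x z <= 0.
  have b := Fsup_norm_le1 gap_formula_norm_le1.
  apply: (le_trans (Finf_le b v x1)); apply: Fsup_le => z z1.
  by rewrite gap_formula_val ge_max lerN10/= ge_min gap0// orbT.
(* Here y is not close to a nonzero projection, and any x will do. *)
have [yd|dy] := leP (rnorm y) (1000 * defect y).
  exists 0; rewrite rnorm0; split=> // z _.
  by rewrite /gap ge_min; apply/orP; left; lra.
have [q [Pq qy _]] := projection_near y.
have q0 : q <> 0.
  by move=> q0; move: qy; rewrite q0 sub0r rnormN; lra.
have [p [[Pp p0 minp] pq]] := minA q Pq q0.
have p1 := rnorm_projection Pp p0.
exists p; split=> [|z z1]; first by rewrite p1.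
have [r [Pr rp rz]] := projection_near_below Pp z1.
rewrite /gap ge_min; apply/orP; right; rewrite ge_max; apply/andP; split.
  rewrite (defect_projection Pp) p1.
  have : rnorm (p ** y - p) <= 1 * rnorm (q - y).
    by rewrite -{2}pq -cmulBr rnorm_distC; apply: rnormM_le => //; rewrite p1.
  by lra.
have : Num.min (rnorm z) (rnorm (p - z)) <= rnorm (r - z); last by lra.
rewrite ge_min; have [->|->] := minp r Pr rp; last by rewrite lexx orbT.
by rewrite sub0r rnormN lexx.
Qed.

(** Minimality is an exact statement recovered from an approximate one, because a
projection of norm less than 1 is 0. *)
Lemma minimality_sentence_dominates_minimal :
  sentence_val A minimality_sentence <= 0 ->
  forall q, projection q -> q <> 0 -> dominates_minimal q.
Proof.
move=> sA q Pq q0.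
have q1 := rnorm_projection Pq q0.
have b1 := Fsup_norm_le1 gap_formula_norm_le1.
have b2 := Finf_norm_le1 b1.
(* The projection p will be within 5000 eps of x, and this distance is
   multiplied by 5000 once more in [gap]. *)
have [eps epsE] : exists eps : R, 5000 * (5000 * eps) = 10^-1.
  by exists (5000^-1 * 5000^-1 * 10^-1); field.
have [x [x1 xs]] : exists x, rnorm x <= 1 /\
    formula_val (Fsup gap_formula) (vcons x (vcons q (fun=> 0))) < eps.
  apply: Finf_lt; apply: (le_lt_trans (Fsup_ge b2 _ _)); first by rewrite q1.
  by apply: (le_lt_trans sA); lra.
have gapx z : rnorm z <= 1 -> gap q x z < eps.
  move=> z1; have := le_lt_trans (Fsup_ge gap_formula_norm_le1 _ z1) xs.
  rewrite gap_formula_val gt_max gt_min => /andP[_ /orP[|//]].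
  by move=> ?; exfalso; lra.
have gapq z : gap q x z = Num.min 1 (Num.max
    (1 - rnorm x + defect x + rnorm (x ** q - x))
    (Num.min (rnorm z) (rnorm (x - z)) - 5000 * (defect z + rnorm (z ** x - z)))).
  rewrite /gap q1 (defect_projection Pq); congr Num.min; first lra.
  by congr Num.max; lra.
have {}gapx z : rnorm z <= 1 ->
    1 - rnorm x + defect x + rnorm (x ** q - x) < eps /\
    Num.min (rnorm z) (rnorm (x - z)) - 5000 * (defect z + rnorm (z ** x - z)) < eps.
  move=> /gapx; rewrite gapq gt_min => /orP[|].
    by move=> ?; exfalso; lra.
  by rewrite gt_max => /andP.
have xq0 := rnorm_ge0 (x ** q - x).
have dx0 : 0 <= defect x by exact: rnorm_ge0.
have [xeps _] := gapx 0 (eq_ind_r (fun t => t <= 1) ler01 (@rnorm0 _ A)).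
have [p [Pp pq px]] := projection_near_below Pq x1.
have {}px : rnorm (p - x) <= 5000 * eps by lra.
exists p; split=> //; split=> //.
  by move=> p0; move: px; rewrite p0 sub0r rnormN; lra.
move=> r Pr rp; apply/or_asboolP; case: asboolP => //= r0; apply/asboolP.
have r1 := rnorm_projection Pr r0.
have [_] := gapx r (eq_ind_r (fun t => t <= 1) (lexx 1) r1).
rewrite r1 (defect_projection Pr).
have : rnorm (r ** x - r) <= 1 * rnorm (p - x).
  by rewrite -{2}rp -cmulBr rnorm_distC; apply: rnormM_le => //; rewrite r1.
move=> rx; have [xr|xr] := leP 1 (rnorm (x - r)).
  by move=> ?; exfalso; lra.
move=> xr'; apply/esym/eqP; rewrite -subr_eq0; apply/eqP.
apply: projection_small; first exact: projectionB.
by have := rnorm_distD x p r; lra.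
Qed.

End Sentence.

Theorem proposition5p4 (R : realType) (A : cstarAlgType R) (q : A) :
  pseudocompact A -> projection q -> q <> 0 ->
  exists p : A, minimal_projection p /\ proj_le p q.
Proof.
move=> [I [U [UU [B [fdB eqvA]]]]].
apply: minimality_sentence_dominates_minimal; rewrite eqvA.
apply: minimality_sentence_le0 => u.
apply: ultraproduct_dominates_minimal => i b.
exact: finite_dimensional_dominates_minimal.
Qed.
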